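(* Let $\mathcal{F}$ and $\mathcal{G}$ be proper nontrivial subspaces of a real or complex Hilbert space $\mathcal{H}$. Then $$\min\left\{\min\{\cos^2(\hat{\Theta}(\mathcal{F},\mathcal{G}))\},\ \min\{\cos^2(\hat{\Theta}(\mathcal{G},\mathcal{F}))\}\right\}=1-\mathrm{gap}^2(\mathcal{F},\mathcal{G}).$$
   Context: A subspace means a closed linear manifold; nontrivial means different from $\{0\}$, proper means different from $\mathcal{H}$. $P_{\mathcal{F}}$ denotes the orthogonal projector onto $\mathcal{F}$; $\Sigma$ denotes the spectrum; $(P_{\mathcal{F}}P_{\mathcal{G}})|_{\mathcal{F}}$ is regarded as an operator $\mathcal{F}\to\mathcal{F}$. The set of angles from $\mathcal{F}$ to $\mathcal{G}$ is $$\hat{\Theta}(\mathcal{F},\mathcal{G})=\{\theta:\theta=\arccos(\sigma),\ \sigma\ge 0,\ \sigma^2\in\Sigma((P_{\mathcal{F}}P_{\mathcal{G}})|_{\mathcal{F}})\}\subseteq[0,\pi/2].$$ A function applied to a set denotes the image of the set. The gap is $\mathrm{gap}(\mathcal{F},\mathcal{G})=\|P_{\mathcal{F}}-P_{\mathcal{G}}\|=\max\{\|P_{\mathcal{F}}P_{\mathcal{G}^\perp}\|,\|P_{\mathcal{G}}P_{\mathcal{F}^\perp}\|\}$, with the operator norm. *)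

(* Defs.v *)
From HB Require Import structures.
From mathcomp Require Import all_boot all_order all_algebra.
From mathcomp Require Import complex.
From mathcomp Require Import all_classical all_reals all_analysis.

Set Implicit Arguments.
Unset Strict Implicit.
Unset Printing Implicit Defensive.

Import Order.TTheory GRing.Theory Num.Theory.
Import numFieldNormedType.Exports.

Local Open Scope classical_set_scope.
Local Open Scope ring_scope.

(* The norm of a [normedModType K] is [K]-valued, whereas angles and gaps are
   elements of [R]: the embedding of [R] into [K] is the last index here. *)
Variant real_or_complex (R : realType) :
    forall K : numFieldType, (K -> K) -> (R -> K) -> Prop :=
  | RealScalars : @real_or_complex R R idfun idfun
  | ComplexScalars : @real_or_complex R R[i] (@Num.conj R[i]) (real_complex R).

Section HilbertGeometry.
Variables (R : realType) (K : numFieldType) (theta : K -> K) (iota : R -> K).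
Variable (H : completeNormedModType K).
Implicit Types (F G : set H) (A B : H -> H).

Definition closed_subspace F := submod_closed [in F] /\ closed F.

Definition is_min (X : set R) (m : R) := X m /\ lbound X m.

(* The values of [A] outside [F] are irrelevant: [A] stands for its
   restriction F -> F. *)
Definition bounded_operator_on F A :=
  [/\ forall x, F x -> F (A x),
      forall (a : K) x y, F x -> F y -> A (a *: x + y) = a *: A x + A y
    & exists M : K, forall x, F x -> `|A x| <= M * `|x|].

Definition spectrum_on F A : set K :=
  [set l | ~ exists B, bounded_operator_on F B /\
     forall x, F x -> B (A x - l *: x) = x /\ A (B x) - l *: B x = x].

Definition opnorm A : R :=
  sup [set r | exists2 x, `|x| <= 1 & iota r = `|A x|].

Variable (dot : {dot H for theta}).

(* The default value 0 is never used when [F] is a closed subspace of a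
   Hilbert space: the set below is then a singleton. *)
Definition orthoproj F (x : H) : H :=
  xget 0 [set y | F y /\ forall z, F z -> dot (x - y) z = 0].

Definition angles F G : set R :=
  [set t | exists s, [/\ t = acos s, 0 <= s
     & spectrum_on F (orthoproj F \o orthoproj G) (iota (s ^+ 2))]].

Definition gap F G : R := opnorm (orthoproj F \- orthoproj G).

End HilbertGeometry.

(* Main.v *)
Require Import Defs.
From HB Require Import structures.
From mathcomp Require Import all_boot all_order all_algebra.
From mathcomp Require Import complex.
From mathcomp Require Import all_classical all_reals all_analysis.
From mathcomp Require Import ring lra.

Set Implicit Arguments.
Unset Strict Implicit.
Unset Printing Implicit Defensive.

Import Order.TTheory GRing.Theory Num.Theory.
Import numFieldNormedType.Exports.

Local Open Scope classical_set_scope.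
Local Open Scope ring_scope.

(** Let P and Q be the orthogonal projectors onto F and G.  For x in F one has
    <P Q x, x> = |Q x|^2, so (P Q)|_F is a bounded symmetric operator with
    quadratic form between 0 and 1, and three facts give the theorem.

    - For any bounded symmetric operator T on a nonzero F, the least real point
      of the spectrum is the largest m such that m |x|^2 <= <T x, x> on F.
      Below m the operator T - l is coercive, hence boundedly invertible
      ([coercive_invertible]).  At m it is not: T - m has a nonnegative form, so
      |(T - m) x|^2 <= M <(T - m) x, x> for a norm bound M of T - m, and a bounded inverse would bound
      <(T - m) x, x> below by a positive multiple of |x|^2, contradicting the
      maximality of m ([max_form_lbound_in_spectrum]).

    - Consequently min cos^2 of the angles from F to G is the largest m1 with
      m1 |x|^2 <= |Q x|^2 on F ([min_cos2_angles]), which by Pythagoras amounts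
      to |x - Q x|^2 <= (1 - m1) |x|^2; in the same way for m2, from G to F.

    - The gap sees exactly the smaller of m1 and m2 ([min_form_lbounds_gap]).
      On F the operator P - Q acts as 1 - Q and on G as P - 1, whence
      1 - gap^2 <= m1 and 1 - gap^2 <= m2.  Conversely
      P x - Q x = P (x - Q x) - (Q x - P Q x) is an orthogonal decomposition
      whose two terms are at most 1 - min(m1, m2) times |x - Q x|^2 and |Q x|^2,
      and these add up to |x|^2.

    Both the existence of projectors and the inversion of coercive operators
    come from one variational statement, [coercive_solve].  The real and the
    complex case are treated together through the real part of the inner
    product. *)

(** * Real and complex scalars *)

Lemma discriminant_le (R : realFieldType) (a b c : R) : 0 <= a ->
  (forall t, 0 <= a * t ^+ 2 + 2 * b * t + c) -> b ^+ 2 <= a * c.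
Proof.
rewrite le_eqVlt => /predU1P[<-|a0] abc.
  have [->|b0] := eqVneq b 0; first by rewrite expr0n mul0r.
  have := abc (- (c + 1) / (2 * b)).
  have -> : 0 * (- (c + 1) / (2 * b)) ^+ 2 + 2 * b * (- (c + 1) / (2 * b)) + c
    = - 1 by field.
  by lra.
have := abc (- b / a).
have -> : a * (- b / a) ^+ 2 + 2 * b * (- b / a) + c = (a * c - b ^+ 2) / a.
  by field; rewrite gt_eqF.
by rewrite pmulr_lge0 ?invr_gt0// subr_ge0.
Qed.

Section HilbertSpace.
Variables (R : realType) (K : numFieldType) (theta : K -> K) (iota : R -> K).
Hypothesis hK : real_or_complex theta iota.

Let iota_zmod : zmod_morphism iota.
Proof. by case: K theta iota / hK => //; exact: rmorphB. Qed.

Let iota_monoid : monoid_morphism iota.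
Proof.
by case: K theta iota / hK => //; split; [exact: rmorph1|exact: rmorphM].
Qed.

HB.instance Definition _ := GRing.isZmodMorphism.Build R K iota iota_zmod.
HB.instance Definition _ := GRing.isMonoidMorphism.Build R K iota iota_monoid.

Let theta_zmod : zmod_morphism theta.
Proof. by case: K theta iota / hK => //; exact: rmorphB. Qed.

Let theta_monoid : monoid_morphism theta.
Proof.
by case: K theta iota / hK => //; split; [exact: rmorph1|exact: rmorphM].
Qed.

HB.instance Definition _ := GRing.isZmodMorphism.Build K K theta theta_zmod.
HB.instance Definition _ := GRing.isMonoidMorphism.Build K K theta theta_monoid.

Lemma ler_iota : {mono iota : r s / r <= s}.
Proof. by case: K theta iota / hK => // r s; rewrite lecE /= eqxx. Qed.

Lemma thetaK : involutive theta.
Proof. by case: K theta iota / hK => //; exact: conjCK. Qed.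

Lemma theta_iota r : theta (iota r) = iota r.
Proof.
case: K theta iota / hK => //.
by rewrite -[LHS]/(conjc _) /= /real_complex_def oppr0.
Qed.

Lemma normK_theta k : `|k| ^+ 2 = k * theta k.
Proof.
case: K theta iota / hK k => k; last exact: normCK.
by rewrite real_normK ?num_real.
Qed.

Lemma has_real_part k : exists r, iota r = (k + theta k) / 2.
Proof.
case: K theta iota / hK k => k; first by exists k => /=; lra.
by exists (complex.Re k); exact: ReJ_add.
Qed.

(** Defined from the conjugation so that one formula serves both fields of
    scalars. *)
Definition repart (k : K) : R := xget 0 [set r | iota r = (k + theta k) / 2].

Lemma iota_repart k : iota (repart k) = (k + theta k) / 2.
Proof.
by apply: (@xgetPex _ 0 [set r | iota r = (k + theta k) / 2]) (has_real_part k).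
Qed.

Lemma iota_inj : injective iota.
Proof. exact: fmorph_inj. Qed.

Lemma ltr_iota : {mono iota : r s / r < s}.
Proof. exact: leW_mono ler_iota. Qed.

Lemma repart_iota r : repart (iota r) = r.
Proof. by apply: iota_inj; rewrite iota_repart theta_iota; field. Qed.

Lemma repartD : {morph repart : k l / k + l}.
Proof.
by move=> k l; apply: iota_inj; rewrite rmorphD /= !iota_repart rmorphD; field.
Qed.

Lemma repartZ r k : repart (iota r * k) = r * repart k.
Proof.
apply: iota_inj; rewrite rmorphM /= !iota_repart (rmorphM theta) /= theta_iota.
by field.
Qed.

Lemma repart_theta k : repart (theta k) = repart k.
Proof. by apply: iota_inj; rewrite !iota_repart thetaK addrC. Qed.

(** A nonnegative scalar is fixed by the conjugation because k * k = |k|^2 =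
    k * theta k; this is what lets norms be read in [R]. *)
Lemma ger0_iota_repart k : 0 <= k -> iota (repart k) = k.
Proof.
move=> k0; have [->|kN0] := eqVneq k 0.
  by rewrite iota_repart rmorph0 addr0 mul0r.
suff tk : theta k = k by rewrite iota_repart tk; field.
by apply: (mulfI kN0); rewrite -normK_theta ger0_norm.
Qed.

(** * The underlying real inner product *)

Variables (H : completeNormedModType K) (dot : {dot H for theta}).
Hypothesis hdot : forall x : H, `|x| ^+ 2 = dot x x.

Definition ip (x y : H) : R := repart (dot x y).
Definition nrm (x : H) : R := repart `|x|.

Lemma iota_nrm x : iota (nrm x) = `|x|.
Proof. exact: ger0_iota_repart. Qed.

Lemma dotC x y : dot x y = theta (dot y x).
Proof. by rewrite (hermC dot) expr0 mul1r. Qed.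

Lemma dotPl k x y z : dot (k *: x + y) z = k * dot x z + dot y z.
Proof. by rewrite linearDl linearZl_LR. Qed.

Lemma dotZr k x y : dot x (k *: y) = theta k * dot x y.
Proof. by rewrite dotC linearZl_LR rmorphM [in RHS]dotC. Qed.

Lemma ipC x y : ip x y = ip y x.
Proof. by rewrite /ip dotC repart_theta. Qed.

Lemma ipDl x y z : ip (x + y) z = ip x z + ip y z.
Proof. by rewrite /ip linearDl repartD. Qed.

Lemma ipZl r x z : ip (iota r *: x) z = r * ip x z.
Proof. by rewrite /ip linearZl_LR repartZ. Qed.

Lemma ipDr x y z : ip x (y + z) = ip x y + ip x z.
Proof. by rewrite ipC ipDl !(ipC x). Qed.

Lemma ipZr r x y : ip x (iota r *: y) = r * ip x y.
Proof. by rewrite ipC ipZl ipC. Qed.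

Lemma ipNl x y : ip (- x) y = - ip x y.
Proof. by rewrite -mulN1r -ipZl rmorphN1 scaleN1r. Qed.

Lemma ipNr x y : ip x (- y) = - ip x y.
Proof. by rewrite ipC ipNl ipC. Qed.

Lemma ip0l y : ip 0 y = 0.
Proof. by rewrite -(scale0r 0) -(rmorph0 iota) ipZl mul0r. Qed.

Definition ipE := (ipDl, ipDr, ipNl, ipNr, ipZl, ipZr, ip0l).

Lemma nrm_ge0 x : 0 <= nrm x.
Proof. by rewrite -ler_iota rmorph0 iota_nrm. Qed.

Lemma nrm_sqr x : nrm x ^+ 2 = ip x x.
Proof. by rewrite /ip -hdot -iota_nrm -rmorphXn repart_iota. Qed.

Lemma ip_ge0 x : 0 <= ip x x.
Proof. by rewrite -nrm_sqr sqr_ge0. Qed.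

Lemma ip_eq0 x : ip x x = 0 -> x = 0.
Proof.
rewrite -nrm_sqr => /eqP; rewrite sqrf_eq0 => /eqP nx0.
by apply/eqP; rewrite -normr_eq0 -iota_nrm nx0 rmorph0.
Qed.

Lemma ip_cauchy_schwarz x y : ip x y ^+ 2 <= ip x x * ip y y.
Proof.
rewrite mulrC; apply: discriminant_le => [|t]; first exact: ip_ge0.
have := ip_ge0 (iota t *: y + x); rewrite !ipE (ipC y x).
lra.
Qed.

Lemma ler_norm_ip x y : `|ip x y| <= nrm x * nrm y.
Proof.
rewrite -(@ler_pXn2r _ 2) ?nnegrE ?mulr_ge0 ?nrm_ge0//.
by rewrite real_normK ?num_real// exprMn !nrm_sqr ip_cauchy_schwarz.
Qed.

Lemma nrmZ r x : nrm (iota r *: x) = `|r| * nrm x.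
Proof.
apply/eqP; rewrite -(@eqrXn2 _ 2) ?mulr_ge0 ?nrm_ge0//.
by rewrite exprMn !nrm_sqr !ipE real_normK ?num_real// mulrA -expr2.
Qed.

Definition linear_on (F : set H) (S : H -> H) := forall k x y, F x -> F y ->
  S (k *: x + y) = k *: S x + S y.
Definition symmetric_on (F : set H) (S : H -> H) := forall x y, F x -> F y ->
  ip (S x) y = ip x (S y).

(** The maximum of this set is the infimum of the Rayleigh quotient of [S] over
    the nonzero vectors of [F]. *)
Definition form_lbounds (F : set H) (S : H -> H) : set R :=
  [set c | forall x, F x -> c * ip x x <= ip (S x) x].
Definition is_max (X : set R) (m : R) := X m /\ ubound X m.

(** * Solving coercive equations on a closed subspace *)

Section ClosedSubspace.
Variable F : set H.
Hypothesis hF : closed_subspace F.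

Lemma subspace0 : F 0.
Proof. by case: hF => -[]; rewrite inE. Qed.

Lemma subspaceP k x y : F x -> F y -> F (k *: x + y).
Proof.
by move=> Fx Fy; case: hF => -[_ /(_ k x y)] + _; rewrite !inE; exact.
Qed.

Lemma subspaceZ k x : F x -> F (k *: x).
Proof.
by move=> Fx; rewrite -(addr0 (k *: x)); apply: subspaceP => //; exact: subspace0.
Qed.

Lemma subspaceB x y : F x -> F y -> F (x - y).
Proof. by move=> Fx Fy; rewrite addrC -scaleN1r; exact: subspaceP. Qed.

Section Coercive.
Variables (S : H -> H) (al M : R) (y : H).
Hypotheses (linS : linear_on F S) (symS : symmetric_on F S).
Hypotheses (al0 : 0 < al) (coerS : forall x, F x -> al * ip x x <= ip (S x) x).
Hypothesis (bndS : forall x, F x -> nrm (S x) <= M * nrm x).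

(* The energy whose critical points u in F solve <S u, z> = <y, z> on F. *)
Let J v := ip (S v) v - 2 * ip y v.
Let d := inf [set J v | v in F].

Let linSB u v : F u -> F v -> S (u - v) = S u - S v.
Proof. by move=> Fu Fv; rewrite addrC -scaleN1r linS// scaleN1r addrC. Qed.

Let J_lbound : has_lbound [set J v | v in F].
Proof.
exists (- ip y y / al) => _ [v Fv <-]; rewrite ler_pdivrMr//.
(* al * J v >= |al v|^2 - 2 <y, al v> >= - |y|^2 *)
have := ip_ge0 (iota al *: v - y); rewrite !ipE (ipC v y) => h.
have := coerS Fv; rewrite -(ler_pM2l al0) /J; nra.
Qed.

Let J_ge v : F v -> d <= J v.
Proof. by move=> Fv; apply: ge_inf => //; exists v. Qed.

Let almost_minimizer e : 0 < e -> exists2 v, F v & J v < d + e.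
Proof.
move=> e0; have [|_ [v Fv <-] ?] := @inf_adherent _ [set J v | v in F] _ e0.
  by split => //; exists (J 0), 0 => //; exact: subspace0.
by exists v.
Qed.

Let J_line u z t : F u -> F z -> J (iota t *: z + u) =
  ip (S z) z * t ^+ 2 + 2 * (ip (S u) z - ip y z) * t + J u.
Proof.
by move=> Fu Fz; rewrite /J linS// !ipE (symS Fz Fu) (ipC z); ring.
Qed.

Let form_ge0 z : F z -> 0 <= ip (S z) z.
Proof.
by move=> Fz; apply: le_trans (coerS Fz); rewrite mulr_ge0 ?ip_ge0// ltW.
Qed.

(** The parabola t |-> J (u + t z) stays above d while its value at 0 is below
    d + e, so its discriminant is small: an almost minimizer almost solves the
    equation. *)
Let residual u z e : F u -> F z -> J u < d + e ->
  (ip (S u) z - ip y z) ^+ 2 <= ip (S z) z * e.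
Proof.
move=> Fu Fz Jue; apply: discriminant_le => [|t]; first exact: form_ge0.
have := J_ge (subspaceP (iota t) Fz Fu); rewrite J_line//; lra.
Qed.

(** Testing the residuals of u and v on w = u - v and subtracting gives
    <S w, w>, which controls |w|^2 by coercivity. *)
Let almost_minimizers_close u v e : F u -> F v -> J u < d + e -> J v < d + e ->
  al * ip (u - v) (u - v) <= 4 * e.
Proof.
move=> Fu Fv Ju Jv; have Fw := subspaceB Fu Fv.
apply: le_trans (coerS Fw) _; set w := u - v.
have := residual Fu Fw Ju; have := residual Fv Fw Jv; rewrite -/w.
have : ip (S w) w = (ip (S u) w - ip y w) - (ip (S v) w - ip y w).
  by rewrite /w linSB// !ipE; ring.
have := form_ge0 Fw; rewrite -/w.
set a := ip (S w) w; set p := ip (S u) w - _; set q := ip (S v) w - _.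
move=> a0 apq hq hp.
have [->|a_gt0] := eqVneq a 0; first by have := J_ge Fu; lra.
rewrite -(ler_pM2l (_ : 0 < a)); last by rewrite lt_def a_gt0.
have := sqr_ge0 (p + q); have : a ^+ 2 = (p - q) ^+ 2 by rewrite apq.
lra.
Qed.

Let minimizing_limit : exists2 u, F u &
  forall e, 0 < e -> exists v, [/\ F v, J v < d + e & nrm (u - v) < e].
Proof.
have inv0 n : 0 < (n.+1%:R : R)^-1 by rewrite invr_gt0 ltr0n.
have /choice[v vP] : forall n, exists v, F v /\ J v < d + n.+1%:R^-1.
  by move=> n; have [v] := almost_minimizer (inv0 n); exists v.
have inv_small (e : R) : 0 < e ->
    exists N, forall n, (N <= n)%N -> n.+1%:R^-1 < e.
  move=> e0; have [N _ hN] := near_infty_natSinv_lt (PosNum e0).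
  by exists N => n Nn; exact: hN.
have /cauchy_cvg vcvg : cauchy (v @ \oo).
  apply: cauchy_exP => e e0; have [r re] : exists r, iota r = e.
    by exists (repart e); apply: ger0_iota_repart; exact: ltW.
  have r0 : 0 < r by rewrite -ltr_iota re rmorph0.
  have [|N hN] := inv_small (al * r ^+ 2 / 4).
    by rewrite divr_gt0// mulr_gt0// exprn_gt0.
  exists (v N); exists N => // n /= Nn.
  rewrite -ball_normE /= -re -iota_nrm ltr_iota.
  rewrite -(@ltr_pXn2r _ 2) ?nnegrE ?nrm_ge0 ?(ltW r0)// nrm_sqr.
  have [FN JN] := vP N; have [Fn Jn] := vP n.
  have Jn' : J (v n) < d + N.+1%:R^-1.
    by apply: lt_le_trans Jn _; rewrite lerD2l lef_pV2 ?posrE ?ltr0n// ler_nat.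
  rewrite -(ltr_pM2l al0).
  have := almost_minimizers_close FN Fn JN Jn'; have := hN _ (leqnn N).
  by set iN := _^-1; set a := ip _ _; move: (r ^+ 2) => r2; lra.
move/cvg_ex : vcvg => [u vu].
exists u => [|e e0].
  apply: (closed_cvg F _ _ _ vu); first by case: hF.
  by exists 0%N => // n _; have [] := vP n.
move/cvgrPdist_lt : vu => /(_ (iota e)); rewrite -[X in X < _](rmorph0 iota).
rewrite ltr_iota => /(_ e0)[N1 _ hN1]; have [N2 hN2] := inv_small _ e0.
exists (v (maxn N1 N2)); have [Fv Jv] := vP (maxn N1 N2); split => //.
  by apply: lt_trans Jv _; rewrite ltrD2l hN2// leq_maxr.
by rewrite -ltr_iota iota_nrm; apply: hN1; exact: leq_maxl.
Qed.

(** The Lax-Milgram theorem for symmetric forms.  Minimizing sequences of [J]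
    are Cauchy, and the residual of their limit is 0. *)
Lemma coercive_solve : exists2 u, F u & forall z, F z -> ip (S u) z = ip y z.
Proof.
have [u Fu approx] := minimizing_limit; exists u => // z Fz.
apply/eqP; rewrite -subr_eq0 -sqrf_eq0 eq_le sqr_ge0 andbT leNgt; apply/negP.
set q := _ ^+ 2 => q0.
pose C := 2 * ip (S z) z + 2 * (M ^+ 2 * ip z z).
have C0 : 0 <= C.
  have := mulr_ge0 (sqr_ge0 M) (ip_ge0 z); have := form_ge0 Fz; rewrite /C; lra.
(* Passing from the limit u to an almost minimizer v costs S (u - v). *)
have key e : 0 < e -> e <= 1 -> q <= C * e.
  move=> e0 e1; have [v [Fv Jv uv]] := approx _ e0.
  have Fw := subspaceB Fu Fv.
  have h1 := residual Fv Fz Jv.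
  have h2 : ip (S (u - v)) z ^+ 2 <= (M ^+ 2 * e) * ip z z.
    apply: le_trans (ip_cauchy_schwarz _ _) _.
    apply: ler_wpM2r; first exact: ip_ge0.
    rewrite -nrm_sqr; apply: (@le_trans _ _ ((M * nrm (u - v)) ^+ 2)).
      by rewrite ler_pXn2r ?nnegrE ?(le_trans _ (bndS Fw)) ?nrm_ge0// bndS.
    rewrite exprMn ler_wpM2l ?sqr_ge0//.
    have := nrm_ge0 (u - v); nra.
  have qE : q = ((ip (S v) z - ip y z) + ip (S (u - v)) z) ^+ 2.
    by rewrite /q linSB// !ipE; congr (_ ^+ 2); ring.
  rewrite qE /C; move: h1 h2; set p1 := _ - _; set p2 := ip (S (u - v)) z.
  have := sqr_ge0 (p1 - p2); lra.
(* For this e the bound is at most q / 2, which contradicts q > 0. *)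
have := key (Num.min 1 (q / (2 * (C + 1)))).
have e1 : 0 < q / (2 * (C + 1)) by rewrite divr_gt0//; lra.
rewrite lt_min ltr01 e1 /= ge_min lexx => /(_ isT isT) qC.
have : C * Num.min 1 (q / (2 * (C + 1))) <= C * (q / (2 * (C + 1))).
  by rewrite ler_wpM2l// ge_min lexx orbT.
have : C * (q / (2 * (C + 1))) <= q / 2.
  rewrite -subr_ge0 (_ : _ - _ = q / (2 * (C + 1))) ?(ltW e1)//.
  by field; rewrite gt_eqF//; lra.
lra.
Qed.

End Coercive.
End ClosedSubspace.

(** * Orthogonal projectors *)

(** A vector of F may be multiplied by the scalar [dot u z], which turns the
    real part of the inner product into its squared modulus. *)
Lemma ip_total (F : set H) u : closed_subspace F ->
  (forall z, F z -> ip u z = 0) -> forall z, F z -> dot u z = 0.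
Proof.
move=> hF u0 z Fz; have := u0 _ (subspaceZ hF (dot u z) Fz).
rewrite /ip dotZr mulrC -normK_theta => re0; apply/eqP.
rewrite -normr_eq0 -sqrf_eq0 -[X in X == 0]ger0_iota_repart ?exprn_ge0//.
by rewrite re0 rmorph0.
Qed.

Section Projection.
Variable F : set H.
Hypothesis hF : closed_subspace F.
Local Notation P := (orthoproj dot F).

Lemma orthoprojP x : F (P x) /\ forall z, F z -> dot (x - P x) z = 0.
Proof.
apply: (@xgetPex _ 0 [set y | F y /\ forall z, F z -> dot (x - y) z = 0]).
have [//|//|//|y Fy|y Fy|u Fu uP] := @coercive_solve F hF idfun 1 1 x.
- by rewrite mul1r.
- by rewrite mul1r.
exists u; split=> //; apply: ip_total => // z Fz.
by rewrite ipDl ipNl uP// subrr.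
Qed.

Lemma orthoproj_in x : F (P x). Proof. by have [] := orthoprojP x. Qed.

Lemma ip_orthoproj_sub x z : F z -> ip (x - P x) z = 0.
Proof.
by have [_ PP] := orthoprojP x => Fz; rewrite /ip PP// -(rmorph0 iota) repart_iota.
Qed.

Lemma orthoproj_unique x y : F y -> (forall z, F z -> ip (x - y) z = 0) ->
  P x = y.
Proof.
move=> Fy yP; apply/eqP; rewrite -subr_eq0; apply/eqP/ip_eq0.
have Fd : F (P x - y) by apply: subspaceB => //; exact: orthoproj_in.
have := yP _ Fd; have := ip_orthoproj_sub x Fd.
set d := P x - y in Fd *; rewrite {3}/d !ipDl !ipNl; lra.
Qed.

Lemma orthoproj_id x : F x -> P x = x.
Proof. by move=> Fx; apply: orthoproj_unique => // z _; rewrite subrr ip0l. Qed.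

Lemma orthoproj_linear k x y : P (k *: x + y) = k *: P x + P y.
Proof.
have [[Fx Px] [Fy Py]] := (orthoprojP x, orthoprojP y).
apply: orthoproj_unique => [|z Fz]; first exact: subspaceP.
rewrite opprD addrACA -scalerBr /ip dotPl Px// Py//.
by rewrite mulr0 addr0 -(rmorph0 iota) repart_iota.
Qed.

Lemma orthoprojZ k x : P (k *: x) = k *: P x.
Proof.
rewrite -[k *: x]addr0 orthoproj_linear (orthoproj_id (subspace0 hF)).
by rewrite addr0.
Qed.

Lemma orthoproj_sub x y : P (x - y) = P x - P y.
Proof. by rewrite addrC -scaleN1r orthoproj_linear scaleN1r addrC. Qed.

Lemma ip_orthoproj x z : F z -> ip (P x) z = ip x z.
Proof. by move=> /ip_orthoproj_sub-/(_ x); rewrite ipDl ipNl; lra. Qed.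

Lemma ip_orthoprojP x y : ip (P x) (P y) = ip x (P y).
Proof. by rewrite ip_orthoproj//; exact: orthoproj_in. Qed.

Lemma orthoproj_sym x y : ip (P x) y = ip x (P y).
Proof. by rewrite -ip_orthoprojP ipC (ipC (P x)) ip_orthoprojP. Qed.

Lemma pythagoras x : ip x x = ip (P x) (P x) + ip (x - P x) (x - P x).
Proof. by rewrite !ipE (ipC (P x) x) !ip_orthoprojP; ring. Qed.

Lemma orthoproj_form x : ip (P x) x = ip (P x) (P x).
Proof. by rewrite orthoproj_sym ip_orthoprojP. Qed.

Lemma orthoproj_form_ge0 x : 0 <= ip (P x) x.
Proof. by rewrite orthoproj_form ip_ge0. Qed.

Lemma orthoproj_le x : ip (P x) (P x) <= ip x x.
Proof. by rewrite (pythagoras x) lerDl ip_ge0. Qed.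

End Projection.

(** * The bottom of the spectrum of a symmetric operator *)

Section Spectrum.
Variable F : set H.
Hypothesis hF : closed_subspace F.

(** The constant of [bounded_operator_on] is a scalar of [K] of which nothing is
    known when [F] is zero; its modulus always is a real bound. *)
Lemma bounded_operatorP A : bounded_operator_on F A ->
  exists2 M : R, 0 <= M & forall x, F x -> nrm (A x) <= M * nrm x.
Proof.
case=> _ _ [M AM]; exists (repart `|M|).
  by rewrite -ler_iota rmorph0 ger0_iota_repart.
move=> x Fx; rewrite -ler_iota rmorphM /= !iota_nrm ger0_iota_repart//.
have := AM _ Fx; have [->|x0] := eqVneq x 0.
  by rewrite normr0 !mulr0.
move=> h; apply: le_trans h _; rewrite ler_wpM2r//.
have Mx0 : 0 <= M * `|x| := le_trans (normr_ge0 _) (AM _ Fx).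
by rewrite real_ler_norm// ger0_real// -(pmulr_lge0 _ (_ : 0 < `|x|)) ?normr_gt0.
Qed.

(** The factor [e] lets the statement serve on both sides of the numerical
    range: 1 for points below it, -1 for points above it. *)
Lemma coercive_invertible A (e al : R) : bounded_operator_on F A ->
    symmetric_on F A -> e != 0 -> 0 < al ->
    (forall x, F x -> al * ip x x <= e * ip (A x) x) ->
  exists B, bounded_operator_on F B /\
    forall x, F x -> B (A x) = x /\ A (B x) = x.
Proof.
move=> bA symA e0 al0 coerA; have [FA linA _] := bA.
have [M M0 AM] := bounded_operatorP bA.
have inj u v : F u -> F v -> A u = A v -> u = v.
  move=> Fu Fv uv; apply/eqP; rewrite -subr_eq0; apply/eqP/ip_eq0.
  have := coerA _ (subspaceB hF Fu Fv).
  have -> : A (u - v) = 0.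
    by rewrite addrC -scaleN1r linA// scaleN1r uv addNr.
  have := ip_ge0 (u - v); rewrite ip0l mulr0 => h1 h2; apply/eqP.
  by rewrite eq_le h1 andbT -(pmulr_rle0 _ al0).
have surj y : F y -> exists u, F u /\ A u = y.
  move=> Fy.
  have [||//||x Fx|u Fu uP] := @coercive_solve F hF (fun x => iota e *: A x)
    al (`|e| * M) (iota e *: y).
  - by move=> k u v Fu Fv; rewrite linA// scalerDr !scalerA mulrC.
  - by move=> u v Fu Fv; rewrite ipZl ipZr symA.
  - by move=> x Fx; rewrite ipZl; exact: coerA.
  - by rewrite nrmZ -mulrA ler_wpM2l// AM.
  exists u; split=> //; apply/eqP; rewrite -subr_eq0; apply/eqP/ip_eq0.
  have Fd := subspaceB hF (FA _ Fu) Fy.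
  have := uP _ Fd; rewrite !ipZl => /(mulfI e0) h.
  by rewrite ipDl h ipNl subrr.
pose B y := xget 0 [set u | F u /\ A u = y].
have BP y : F y -> F (B y) /\ A (B y) = y.
  by move=> Fy; exact: (@xgetPex _ 0 [set u | F u /\ A u = y]) (surj _ Fy).
have FB y : F y -> F (B y) by move=> /BP[].
have AB y : F y -> A (B y) = y by move=> /BP[].
exists B; split=> [|x Fx]; last first.
  by split; [apply: inj => //; [exact/FB/FA|exact/AB/FA]|exact: AB].
split=> [//|k x y Fx Fy|].
  have [Fxy FBx FBy] := And3 (subspaceP hF k Fx Fy) (FB _ Fx) (FB _ Fy).
  by apply: inj; [exact: FB|exact: subspaceP|rewrite linA// !AB].
exists (iota (`|e| / al)) => x Fx; rewrite -!iota_nrm -rmorphM /= ler_iota.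
have FBx := FB _ Fx; have [n0|n0] := eqVneq (nrm (B x)) 0.
  by rewrite n0 mulr_ge0 ?nrm_ge0// divr_ge0// ltW.
have n_gt0 : 0 < nrm (B x) by rewrite lt_def n0 nrm_ge0.
have := coerA _ FBx; rewrite AB// -nrm_sqr => h.
have h2 : e * ip x (B x) <= `|e| * (nrm x * nrm (B x)).
  by apply: le_trans (ler_norm _) _; rewrite normrM ler_wpM2l// ler_norm_ip.
rewrite mulrAC ler_pdivlMr// -(ler_pM2r n_gt0); nra.
Qed.

(** The Cauchy-Schwarz inequality for the semidefinite form <S x, y>, applied to
    x and S x. *)
Lemma nonneg_form_sqr_le (S : H -> H) M x : bounded_operator_on F S ->
  symmetric_on F S -> (forall y, F y -> 0 <= ip (S y) y) ->
  (forall y, F y -> nrm (S y) <= M * nrm y) ->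
  F x -> ip (S x) (S x) <= M * ip (S x) x.
Proof.
move=> [FS linS _] symS S0 SM Fx; have FSx := FS _ Fx.
have h : ip (S x) (S x) ^+ 2 <= ip (S (S x)) (S x) * ip (S x) x.
  apply: discriminant_le => [|t]; first exact: S0.
  have := S0 _ (subspaceP hF (iota t) FSx Fx).
  rewrite linS// !ipE (symS (S x) x)//; move: (ip (S (S x)) (S x)) => a; lra.
have [n0|n0] := eqVneq (ip (S x) (S x)) 0.
  by rewrite n0 (ip_eq0 n0) ip0l mulr0.
have n_gt0 : 0 < ip (S x) (S x) by rewrite lt_def n0 ip_ge0.
rewrite -(ler_pM2l n_gt0) -expr2; apply: le_trans h _.
rewrite mulrA ler_wpM2r ?S0// [leRHS]mulrC -nrm_sqr.
apply: le_trans (ler_norm _) _; apply: le_trans (ler_norm_ip _ _) _.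
by rewrite expr2 mulrA ler_wpM2r ?nrm_ge0// SM.
Qed.

Section MinSpectrum.
Variable T : H -> H.
Hypotheses (bT : bounded_operator_on F T) (symT : symmetric_on F T).

Let A l x := T x - iota l *: x.

Let bA l : bounded_operator_on F (A l).
Proof.
have [FT linT [M TM]] := bT.
split=> [x Fx|k x y Fx Fy|].
- by apply: subspaceB => //; [exact: FT|exact: subspaceZ].
- rewrite /A linT// scalerDr opprD addrACA scalerBr; congr (_ - _ + _).
  by rewrite !scalerA mulrC.
- exists (M + `|iota l|) => x Fx; apply: le_trans (ler_normB _ _) _.
  by rewrite normrZ mulrDl lerD2r TM.
Qed.

Let symA l : symmetric_on F (A l).
Proof. by move=> x y Fx Fy; rewrite /A !ipE symT. Qed.

Lemma not_in_spectrum l e al : e != 0 -> 0 < al ->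
  (forall x, F x -> al * ip x x <= e * (ip (T x) x - l * ip x x)) ->
  ~ spectrum_on F T (iota l).
Proof.
move=> e0 al0 coer; apply; apply: (coercive_invertible (@bA l) (@symA l) e0 al0).
by move=> x Fx; rewrite /A !ipE; exact: coer.
Qed.

Lemma spectrum_lower_bound m l : form_lbounds F T m ->
  spectrum_on F T (iota l) -> m <= l.
Proof.
move=> Tm; rewrite leNgt => sl; apply/negP => lm; move: sl.
apply: (@not_in_spectrum l 1 (m - l)); rewrite ?oner_eq0 ?subr_gt0// => x Fx.
by rewrite mul1r mulrBl lerD2r Tm.
Qed.

Lemma spectrum_upper_bound m l :
  (forall x, F x -> ip (T x) x <= m * ip x x) ->
  spectrum_on F T (iota l) -> l <= m.
Proof.
move=> Tm; rewrite leNgt => sl; apply/negP => lm; move: sl.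
apply: (@not_in_spectrum l (-1) (l - m)); rewrite ?oppr_eq0 ?oner_eq0 ?subr_gt0//.
by move=> x /Tm; lra.
Qed.

(** With a bounded inverse B of T - m, |x|^2 = |B (T - m) x|^2 is at most a
    multiple of |(T - m) x|^2, hence of <(T - m) x, x>, so m could be
    increased. *)
Lemma max_form_lbound_in_spectrum m : is_max (form_lbounds F T) m ->
  spectrum_on F T (iota m).
Proof.
move=> [Tm m_max] [B [bB BA]].
have [C C0 BC] := bounded_operatorP bB.
have [M M0 AM] := bounded_operatorP (bA m).
have A0 y : F y -> 0 <= ip (A m y) y by move=> Fy; rewrite !ipE subr_ge0 Tm.
have key x : F x -> ip x x <= C ^+ 2 * M * ip (A m x) x.
  move=> Fx; have [FA _ _] := bA m; have FAx := FA _ Fx.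
  rewrite -mulrA; apply: (@le_trans _ _ (C ^+ 2 * ip (A m x) (A m x))).
    rewrite -!nrm_sqr -exprMn ler_pXn2r// ?nnegrE ?mulr_ge0 ?nrm_ge0//.
    by have := BC _ FAx; rewrite (BA _ Fx).1.
  rewrite ler_wpM2l ?sqr_ge0//.
  exact: nonneg_form_sqr_le (bA m) (symA m) A0 AM Fx.
have D0 : 0 < C ^+ 2 * M + 1 by rewrite ltr_wpDl// mulr_ge0// sqr_ge0.
suff : m + (C ^+ 2 * M + 1)^-1 <= m by rewrite gerDl leNgt invr_gt0 D0.
apply: m_max => x Fx; rewrite mulrDl -lerBrDl ler_pdivrMl// mulrDl mul1r.
by have := key x Fx; have := A0 x Fx; rewrite !ipE; lra.
Qed.

Lemma max_form_lbound_exists : (exists2 x, F x & x <> 0) ->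
  exists m, is_max (form_lbounds F T) m.
Proof.
move=> [x0 Fx0 x0N0]; pose X := form_lbounds F T.
have ip_gt0 x : x <> 0 -> 0 < ip x x.
  by move=> xN0; rewrite lt_def ip_ge0 andbT; apply/eqP => /ip_eq0.
have X0 : X !=set0.
  have [M M0 TM] := bounded_operatorP bT; exists (- M) => x Fx.
  rewrite mulNr lerNl -nrm_sqr; apply: le_trans (ler_norm _) _.
  rewrite normrN; apply: le_trans (ler_norm_ip _ _) _.
  by rewrite expr2 mulrA ler_wpM2r ?nrm_ge0 ?TM.
have Xub : has_ubound X.
  exists (ip (T x0) x0 / ip x0 x0) => c /(_ _ Fx0) cx0.
  by rewrite ler_pdivlMr ?ip_gt0.
exists (sup X); split=> [x Fx|]; last exact: ub_le_sup.
have [->|/eqP xN0] := eqVneq x 0; first by rewrite (ipC _ 0) !ip0l mulr0.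
rewrite -ler_pdivlMr ?ip_gt0//; apply: ge_sup => // c /(_ _ Fx) cx.
by rewrite ler_pdivlMr ?ip_gt0.
Qed.

End MinSpectrum.
End Spectrum.

(** * Angles between two subspaces *)

Section Angles.
Variables F G : set H.
Hypotheses (hF : closed_subspace F) (hG : closed_subspace G).
Local Notation PF := (orthoproj dot F).
Local Notation PG := (orthoproj dot G).

Lemma subspace_neq0 : F <> [set 0] -> exists2 x, F x & x <> 0.
Proof.
move=> F0; apply: contrapT => noF; apply: F0; apply/seteqP; split=> x.
  by move=> Fx; apply: contrapT => x0; apply: noF; exists x.
by move=> ->; exact: subspace0.
Qed.

Lemma proj_proj_bounded : bounded_operator_on F (PF \o PG).
Proof.
split=> [x _|k x y _ _|]; first exact: orthoproj_in.
  by rewrite /= !orthoproj_linear.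
exists 1 => x _; rewrite mul1r /= -!iota_nrm ler_iota.
rewrite -(@ler_pXn2r _ 2) ?nnegrE ?nrm_ge0// !nrm_sqr.
exact: le_trans (orthoproj_le hF _) (orthoproj_le hG _).
Qed.

Lemma ip_proj_proj x y : F y -> ip ((PF \o PG) x) y = ip (PG x) y.
Proof. exact: ip_orthoproj. Qed.

(** The maximum m of the lower bounds is the least real point of the spectrum.
    All its real points lie in [0, 1], where cos (acos s) = s, so the squared
    cosines of the angles are exactly these points. *)
Lemma min_cos2_angles : F <> [set 0] -> exists m,
  [/\ is_min [set cos t ^+ 2 | t in angles iota dot F G] m, m <= 1
    & is_max (form_lbounds F PG) m].
Proof.
move=> F0; have bT := proj_proj_bounded.
have symT : symmetric_on F (PF \o PG).
  move=> x y Fx Fy; rewrite ip_proj_proj// [RHS]ipC ip_proj_proj//.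
  by rewrite (orthoproj_sym hG) ipC.
have [m m_max] := max_form_lbound_exists bT (subspace_neq0 F0).
have m_spec := max_form_lbound_in_spectrum hF bT symT m_max.
have [Tm m_sup] := m_max.
have T1 x : F x -> ip ((PF \o PG) x) x <= 1 * ip x x.
  by move=> Fx; rewrite ip_proj_proj// mul1r orthoproj_form// orthoproj_le.
have le1 l : spectrum_on F (PF \o PG) (iota l) -> l <= 1.
  exact: spectrum_upper_bound T1.
have m0 : 0 <= m.
  by apply: m_sup => x Fx; rewrite mul0r ip_proj_proj// orthoproj_form_ge0.
have cos_acos s : 0 <= s -> s ^+ 2 <= 1 -> cos (acos s) = s.
  move=> s0; rewrite expr_le1// => s1; apply: acosK.
  by rewrite in_itv /= s1 andbT; lra.
exists m; split; [|exact: le1|].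
  split.
    exists (acos (Num.sqrt m)).
      by exists (Num.sqrt m); split; rewrite ?sqrtr_ge0 ?sqr_sqrtr.
    by rewrite cos_acos ?sqr_sqrtr ?sqrtr_ge0 ?le1.
  move=> _ [_ [s [-> s0 s_spec]] <-]; rewrite cos_acos ?le1//.
  exact: spectrum_lower_bound Tm s_spec.
split=> [x Fx|c cG]; first by rewrite -ip_proj_proj// Tm.
by apply: m_sup => x Fx; rewrite ip_proj_proj// cG.
Qed.

End Angles.

(** * The gap *)

Section OperatorNorm.
Variables (D : H -> H) (C : R).
Hypotheses (linD : forall k x, D (k *: x) = k *: D x) (C0 : 0 <= C).
Hypothesis DC : forall x, nrm (D x) <= C * nrm x.

Let X := [set r | exists2 x, `|x| <= 1 & iota r = `|D x|].

Let X_ub : ubound X C.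
Proof.
move=> r [x x1]; rewrite -iota_nrm => /iota_inj ->.
apply: le_trans (DC x) _; rewrite -[leRHS]mulr1 ler_wpM2l//.
by rewrite -ler_iota iota_nrm rmorph1.
Qed.

Lemma opnorm_le : opnorm iota D <= C.
Proof.
apply: ge_sup X_ub; exists (nrm (D 0)), 0; rewrite ?normr0 ?ler01//.
exact: iota_nrm.
Qed.

Lemma opnorm_ge x : nrm (D x) <= opnorm iota D * nrm x.
Proof.
have [x0|xN0] := eqVneq (nrm x) 0.
  by have := DC x; rewrite x0 !mulr0.
have x_gt0 : 0 < nrm x by rewrite lt_def xN0 nrm_ge0.
rewrite -ler_pdivrMr//; apply: ub_le_sup; first by exists C.
have nu : nrm (iota (nrm x)^-1 *: x) = 1.
  by rewrite nrmZ ger0_norm ?invr_ge0 ?nrm_ge0// mulVf.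
exists (iota (nrm x)^-1 *: x); first by rewrite -iota_nrm nu rmorph1.
by rewrite -iota_nrm linD nrmZ ger0_norm ?invr_ge0 ?nrm_ge0// mulrC.
Qed.

Lemma opnorm_ge0 : 0 <= opnorm iota D.
Proof.
have D0 : D 0 = 0 by rewrite -[X in D X](scale0r (0 : H)) linD scale0r.
apply: ub_le_sup; first by exists C.
by exists 0; rewrite ?normr0 ?ler01// D0 normr0 rmorph0.
Qed.

End OperatorNorm.

Lemma opnorm_sqr_bounds D m : (forall k x, D (k *: x) = k *: D x) ->
  m <= 1 -> (forall x, ip (D x) (D x) <= (1 - m) * ip x x) ->
  m <= 1 - opnorm iota D ^+ 2 /\
  forall x, ip (D x) (D x) <= opnorm iota D ^+ 2 * ip x x.
Proof.
move=> linD m1 Dm.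
have C0 := sqrtr_ge0 (1 - m).
have DC x : nrm (D x) <= Num.sqrt (1 - m) * nrm x.
  rewrite -(@ler_pXn2r _ 2) ?nnegrE ?mulr_ge0 ?nrm_ge0//.
  by rewrite exprMn !nrm_sqr sqr_sqrtr ?subr_ge0.
have g0 := opnorm_ge0 linD C0 DC; split=> [|x].
  have : opnorm iota D ^+ 2 <= 1 - m.
    by rewrite -[leRHS]sqr_sqrtr ?subr_ge0// ler_pXn2r ?nnegrE// opnorm_le.
  lra.
rewrite -!nrm_sqr -exprMn ler_pXn2r ?nnegrE ?mulr_ge0 ?nrm_ge0//.
exact: opnorm_ge linD C0 DC x.
Qed.

Section Gap.
Variables F G : set H.
Hypotheses (hF : closed_subspace F) (hG : closed_subspace G).
Local Notation PF := (orthoproj dot F).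
Local Notation PG := (orthoproj dot G).

Lemma ip_orthogonal_sub x y : ip y x = 0 ->
  ip (x - y) (x - y) = ip x x + ip y y.
Proof. by move=> xy0; rewrite !ipE (ipC x y) xy0; ring. Qed.

Lemma ip_sub_orthoproj x : ip (x - PG x) (x - PG x) = ip x x - ip (PG x) x.
Proof. by rewrite orthoproj_form// (pythagoras hG x); ring. Qed.

(** The bound on G applies to z = PG x directly.  The bound on F is used in dual
    form: |(1 - PG) PF|^2 <= 1 - m yields the same for the adjoint PF (1 - PG),
    which is what acts on y = x - PG x. *)
Lemma proj_sub_sqr_le m x : m <= 1 ->
  form_lbounds F PG m -> form_lbounds G PF m ->
  ip (PF x - PG x) (PF x - PG x) <= (1 - m) * ip x x.
Proof.
move=> m1 FG GF; set y := x - PG x; set z := PG x.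
have FPy : F (PF y) by exact: orthoproj_in.
have Gz : G z by exact: orthoproj_in.
have split_sq : ip (PF x - PG x) (PF x - PG x) =
    ip (PF y) (PF y) + ip (z - PF z) (z - PF z).
  have -> : PF x - PG x = PF y - (z - PF z).
    by rewrite /y orthoproj_sub// opprB addrA subrK.
  exact/ip_orthogonal_sub/ip_orthoproj_sub.
have z_le : ip (z - PF z) (z - PF z) <= (1 - m) * ip z z.
  have := pythagoras hF z; have := GF _ Gz; rewrite (orthoproj_form hF); lra.
have y_le : ip (PF y) (PF y) <= (1 - m) * ip y y.
  set w := PF y.
  have w_le : ip (w - PG w) (w - PG w) <= (1 - m) * ip w w.
    by have := FG _ FPy; rewrite ip_sub_orthoproj -/w; lra.
  have wE : ip w w = ip y (w - PG w).
    have yPw : ip y (PG w) = 0.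
      by apply: (ip_orthoproj_sub hG); exact: (orthoproj_in hG).
    by rewrite ipDr ipNr yPw subr0 {1 2}/w (ip_orthoprojP hF).
  have := ip_cauchy_schwarz y (w - PG w); rewrite -wE => h.
  have [w0|w0] := eqVneq (ip w w) 0.
    by rewrite w0 mulr_ge0 ?subr_ge0 ?ip_ge0.
  have w_gt0 : 0 < ip w w by rewrite lt_def w0 ip_ge0.
  rewrite -(ler_pM2l w_gt0) -expr2; apply: le_trans h _.
  by rewrite mulrA [leRHS]mulrC ler_wpM2l ?ip_ge0// [leRHS]mulrC.
rewrite split_sq (pythagoras hG x) -/z -/y; lra.
Qed.

Lemma form_lbound_of_sub g : (forall x,
    ip (PF x - PG x) (PF x - PG x) <= g * ip x x) ->
  form_lbounds F PG (1 - g).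
Proof.
move=> Dg x Fx; have := Dg x.
rewrite (orthoproj_id hF Fx) ip_sub_orthoproj; lra.
Qed.

End Gap.

Lemma min_form_lbounds_gap F G m1 m2 :
    closed_subspace F -> closed_subspace G -> m1 <= 1 ->
    is_max (form_lbounds F (orthoproj dot G)) m1 ->
    is_max (form_lbounds G (orthoproj dot F)) m2 ->
  Num.min m1 m2 = 1 - gap iota dot F G ^+ 2.
Proof.
move=> hF hG m1_le1 [FG m1_max] [GF m2_max]; pose m := Num.min m1 m2.
have m_le1 : m <= 1 by rewrite ge_min m1_le1.
have FGm : form_lbounds F (orthoproj dot G) m.
  move=> x Fx; apply: le_trans (FG _ Fx).
  by rewrite ler_wpM2r ?ge_min ?lexx ?ip_ge0.
have GFm : form_lbounds G (orthoproj dot F) m.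
  move=> x Gx; apply: le_trans (GF _ Gx).
  by rewrite ler_wpM2r ?ge_min ?lexx ?orbT ?ip_ge0.
pose D := orthoproj dot F \- orthoproj dot G.
have linD k x : D (k *: x) = k *: D x.
  by rewrite /D /= !orthoprojZ// scalerBr.
have Dm x : ip (D x) (D x) <= (1 - m) * ip x x by exact: proj_sub_sqr_le.
have [m_le gapD] := opnorm_sqr_bounds linD m_le1 Dm.
apply/eqP; rewrite eq_le m_le /= le_min; apply/andP; split.
  exact/m1_max/form_lbound_of_sub.
apply: m2_max; apply: form_lbound_of_sub => // x.
by rewrite -(opprB (orthoproj dot F x)) ipNl ipNr opprK; exact: gapD.
Qed.

End HilbertSpace.

Theorem theorem2p12 (R : realType) (K : numFieldType) (theta : K -> K)
    (iota : R -> K) (hK : real_or_complex theta iota)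
    (H : completeNormedModType K) (dot : {dot H for theta})
    (hdot : forall x : H, `|x| ^+ 2 = dot x x)
    (F G : set H)
    (hF : closed_subspace F) (hG : closed_subspace G)
    (F0 : F <> [set 0]) (FT : F <> setT) (G0 : G <> [set 0]) (GT : G <> setT) :
  exists m1 m2 : R,
    [/\ is_min [set cos t ^+ 2 | t in angles iota dot F G] m1,
        is_min [set cos t ^+ 2 | t in angles iota dot G F] m2
      & Num.min m1 m2 = 1 - gap iota dot F G ^+ 2].
Proof.
have [m1 [min1 m1_le1 m1_max]] := min_cos2_angles hK hdot hF hG F0.
have [m2 [min2 _ m2_max]] := min_cos2_angles hK hdot hG hF G0.
exists m1, m2; split=> //.
exact (min_form_lbounds_gap hK hdot hF hG m1_le1 m1_max m2_max).
Qed.
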